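(* If $E\subset\mathbb{R}$ is $\operatorname{Lip}1$, then $E$ is a weakly dense $G_\delta$ set.
   Context: For a continuous $f:\mathbb{R}\to\mathbb{R}$, $x\in\mathbb{R}$ and $r>0$ put $M_f(x,r)=\frac{1}{r}\sup\{|f(x)-f(y)|:|x-y|\le r\}$ and $\operatorname{Lip} f(x)=\limsup_{r\to0^+}M_f(x,r)$. A set $E\subseteq\mathbb{R}$ is $\operatorname{Lip}1$ if there is a continuous $f:\mathbb{R}\to\mathbb{R}$ with $\operatorname{Lip} f=\mathbf{1}_E$ (the characteristic function of $E$). $|A|$ denotes the Lebesgue measure of $A$. For a sequence of non-degenerate closed intervals $\{I_n\}$, write $I_n\to x$ if $x\in I_n$ for all $n\in\mathbb{N}$ and $|I_n|\to0$. A measurable set $E$ is weakly dense at $x$ if there exists $I_n\to x$ with $\frac{|E\cap I_n|}{|I_n|}\to1$; $E$ is weakly dense if it is weakly dense at every $x\in E$. *)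

(* Defs.v *)
From mathcomp Require Import all_boot all_order all_algebra.
From mathcomp Require Import all_classical all_reals all_analysis borel_hierarchy.

Set Implicit Arguments.
Unset Strict Implicit.
Unset Printing Implicit Defensive.

Import Order.TTheory GRing.Theory Num.Theory.
Import numFieldNormedType.Exports.

Local Open Scope classical_set_scope.
Local Open Scope ring_scope.

(* The supremum is taken in the extended reals, so no boundedness side
   condition is needed; for continuous f it is finite. *)
Definition oscillation_quotient (R : realType) (f : R -> R) (x r : R) : \bar R :=
  ((r^-1)%:E * ereal_sup [set `|f x - f y|%:E | y in [set y | (`|x - y| <= r)%R]])%E.

Definition Lip (R : realType) (f : R -> R) (x : R) : \bar R :=
  limf_esup (oscillation_quotient f x) 0^'+.

Definition Lip1 (R : realType) (E : set R) : Prop :=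
  exists f : R -> R, continuous f /\ forall x, Lip f x = (\1_E x)%:E.

(* [measurable] on R means Borel in the library; the Lebesgue measurable sets
   are the Caratheodory measurable sets of the Lebesgue outer measure, the
   domain of [completed_lebesgue_measure]. *)
Definition Lebesgue_measurable (R : realType) (E : set R) : Prop :=
  (@wlength R idfun)^*%mu.-cara.-measurable E.

Definition nondegenerate_closed_itv (R : realType) (I : set R) : Prop :=
  exists a b : R, a < b /\ I = `[a, b]%classic.

Definition itv_shrink_to (R : realType) (I : (set R)^nat) (x : R) : Prop :=
  [/\ forall n, nondegenerate_closed_itv (I n),
      forall n, I n x &
      completed_lebesgue_measure (I n) @[n --> \oo] --> 0%E].

Definition weakly_dense_at (R : realType) (E : set R) (x : R) : Prop :=
  exists I : (set R)^nat, itv_shrink_to I x /\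
    (completed_lebesgue_measure (E `&` I n) / completed_lebesgue_measure (I n))%E
      @[n --> \oo] --> 1%E.

Definition weakly_dense (R : realType) (E : set R) : Prop :=
  Lebesgue_measurable E /\ forall x, E x -> weakly_dense_at E x.

(* Main.v *)
(* E is G_delta because Lip f only takes the values 0 and 1, so x is in E iff at
   every scale some y near x has |f x - f y| > |x - y| / 2, an open condition.
   For weak density, |f b - f a| <= |E `&` [a, b]|: take U open containing
   E `&` [a, b] with nearly the same measure; at points of E the slope of f is
   locally at most 1 + e and nearby points lie in U, while elsewhere the slope is
   locally at most e, so f grows no faster than (1 + e)|U `&` ]-oo, t]| + e t.
   Given x in E, choosing y_n -> x with |f x - f y_n| / |x - y_n| -> 1 then
   forces E to fill almost all of the interval between x and y_n. *)
Require Import Defs.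
From mathcomp Require Import all_boot all_order all_algebra.
From mathcomp Require Import all_classical all_reals all_analysis borel_hierarchy.
From mathcomp Require Import ring lra.
Import Order.TTheory GRing.Theory Num.Theory.
Import numFieldNormedType.Exports.
Local Open Scope classical_set_scope.
Local Open Scope ring_scope.

(** The limsup is at most the supremum of the quotients over radii in []0, d[]. Some radius [r] thus
    has a [y] with [c * r < |f x - f y|], and [0 <= c] lets [|x - y|] replace [r]. *)
Lemma Lip_gt {R : realType} {f : R -> R} {x c : R} :
  0 <= c -> (c%:E < Lip f x)%E ->
  forall d : R, 0 < d -> exists2 y, `|x - y| < d & c * `|x - y| < `|f x - f y|.
Proof.
move=> c0 cL d d0.
have : (c%:E < ereal_sup
    [set oscillation_quotient f x r | r in [set r | (0 < r < d)%R]])%E.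
  apply: (lt_le_trans cL); apply: ereal_inf_lbound.
  exists [set r | 0 < r < d] => //.
  near=> r; apply/andP; split; near: r.
    exact: nbhs_right_gt.
  exact: nbhs_right_lt.
move=> /ereal_sup_gtP[_ [r /= /andP[r0 rd] <-]].
rewrite /oscillation_quotient lte_pdivlMl// -EFinM => /ereal_sup_gtP[_ [y /= xyr <-]].
rewrite lte_fin => cry; exists y; first exact: le_lt_trans xyr rd.
by apply: le_lt_trans cry; rewrite mulrC ler_wpM2r.
Unshelve. all: by end_near.
Qed.

(** Near 0 all quotients stay below [c]; the one of radius exactly [|x - y|] has [y] among its
    competitors. *)
Lemma Lip_lt {R : realType} {f : R -> R} {x c : R} :
  (Lip f x < c%:E)%E ->
  exists2 d, 0 < d & forall y, `|x - y| < d -> `|f x - f y| <= c * `|x - y|.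
Proof.
move=> /ereal_inf_ltP[_ [V V0 <-]] Vc.
have [d /= d0 dV] := V0; exists d => // y xyd.
have [->|xy] := eqVneq x y; first by rewrite !subrr normr0 mulr0.
have r0 : 0 < `|x - y| by rewrite normr_gt0 subr_eq0.
have Vr : V `|x - y| by apply: dV => //=; rewrite sub0r normrN normr_id.
have : (oscillation_quotient f x `|x - y|%R < c%:E)%E.
  by apply: le_lt_trans Vc; apply: ereal_sup_ubound; exists `|x - y|.
rewrite /oscillation_quotient lte_pdivrMl// -EFinM mulrC => h.
rewrite -lee_fin; apply/ltW/le_lt_trans/h.
by apply: ereal_sup_ubound; exists y => /=.
Qed.

Lemma Lip1_Gdelta {R : realType} {E : set R} : Lip1 E -> Gdelta E.
Proof.
move=> [f [cf fE]].
(* For fixed [y] both conditions are strict inequalities between continuous functions of [x], hence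
   open. *)
exists (fun n => \bigcup_(y in setT)
  [set x | `|x - y| < n.+1%:R^-1 /\ 2^-1 * `|x - y| < `|f x - f y|]).
  move=> n; apply: bigcup_open => y _.
  have cd : continuous (fun x : R => `|x - y|).
    by move=> x; apply: cvg_norm; apply: cvgB; [exact: cvg_id|exact: cvg_cst].
  pose h x := `|f x - f y| - 2^-1 * `|x - y|.
  rewrite (_ : [set _ | _] = (fun x : R => `|x - y|) @^-1` [set u | u < n.+1%:R^-1]
      `&` h @^-1` [set u | 0 < u]); last first.
    by apply/seteqP; split=> x /=; rewrite /h subr_gt0.
  apply: openI; first by apply: open_comp => [x _|]; [exact: cd|exact: open_lt].
  apply: open_comp; last exact: open_gt.
  move=> x _; apply: cvgB; last by apply: cvgM; [exact: cvg_cst|exact: cd].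
  by apply: cvg_norm; apply: cvgB; [exact: cf|exact: cvg_cst].
apply/seteqP; split=> x.
  move=> Ex n _; have [|||y xy fxy] := @Lip_gt R f x 2^-1 _ _ n.+1%:R^-1.
  - by rewrite invr_ge0.
  - by rewrite fE indicE mem_set// lte_fin invf_lt1 ?ltr1n.
  - by rewrite invr_gt0.
  - by exists y.
move=> Ux; apply: contrapT => Ex.
have [|d d0 xd] := @Lip_lt R f x 2^-1.
  by rewrite fE indicE memNset// lte_fin invr_gt0.
have [n nd] : exists n, n.+1%:R^-1 < d.
  by have [n _ /(_ n (leqnn n))] := near_infty_natSinv_lt (PosNum d0); exists n.
have [y _ [xy fxy]] := Ux n I.
by have := xd y (lt_trans xy nd); rewrite leNgt fxy.
Qed.

(* Continuity of [f] and [g] is not assumed: the supremum of the points [t] for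
   which the bound holds on [a, t] is handled by the two-sided local bound there. *)
Lemma le_increment {R : realType} {f g : R -> R} {a b : R} : a <= b ->
  {homo g : x y / x <= y} ->
  (forall t, a <= t <= b -> exists2 d, 0 < d &
     forall s, `|t - s| < d -> `|f t - f s| <= `|g t - g s|) ->
  `|f b - f a| <= g b - g a.
Proof.
move=> ab gh loc.
pose S := [set t | a <= t <= b /\ `|f t - f a| <= g t - g a].
have Sa : S a by split; rewrite ?lexx// !subrr normr0.
have hS : has_sup S by split; [exists a|exists b => t [/andP[]]].
pose c := sup S.
have ac : a <= c by exact: (ub_le_sup hS.2).
have cb : c <= b by apply: ge_sup; [exists a|move=> t [/andP[]]].
have [d d0 cd] := loc c (introT andP (conj ac cb)).
have [t [/andP[at_ tb] St] ct] := sup_adherent d0 hS.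
have tc : t <= c by apply: (ub_le_sup hS.2); split => //; apply/andP.
(* The bound around [c] is used twice: from a point [t] of [S] just below [c] it gives [S c], then
   it passes to some [s > c] and contradicts the supremum. As [g] is monotone, its increments add up
   without absolute values. *)
have Sc : `|f c - f a| <= g c - g a.
  have /cd : `|c - t| < d by rewrite ger0_norm ?subr_ge0// ltrBlDr -ltrBlDl.
  rewrite (ger0_norm (x := g c - _)) ?subr_ge0 ?gh// => ?.
  have := ler_distD (f t) (f c) (f a); lra.
have [cb'|bc] := ltP c b; last by have -> : b = c by apply/le_anti/andP.
pose s := Num.min b (c + d / 2).
have cs : c < s by rewrite lt_min cb'/=; lra.
have sb : s <= b by rewrite ge_min lexx.
have : s <= c + d / 2 by rewrite ge_min lexx orbT.
move=> scd.
suff : S s by move=> /(ub_le_sup hS.2); rewrite leNgt -/c cs.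
split; first by rewrite sb (le_trans ac (ltW cs)).
have /cd : `|c - s| < d by rewrite distrC ger0_norm ?subr_ge0 ?ltW//; lra.
rewrite distrC (distrC (g c)) (ger0_norm (x := g s - _)) ?subr_ge0 ?gh ?(ltW cs)// => ?.
have := ler_distD (f c) (f s) (f a); lra.
Qed.

Lemma Lip_increment {R : realType} {f : R -> R} {E : set R} {a b : R} :
  measurable E -> (forall x, Lip f x = (\1_E x)%:E) -> a <= b ->
  (`|f b - f a|%:E <= lebesgue_measure (E `&` `[a, b]))%E.
Proof.
move=> mE fE ab.
set D := E `&` `[a, b].
have mD : measurable D by exact: measurableI.
have Dfin : (lebesgue_measure D < +oo)%E.
  apply: le_lt_trans (_ : (lebesgue_measure `[a, b]%classic < +oo)%E).
    by apply: le_measure; rewrite ?inE//; exact: subIsetr.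
  by rewrite lebesgue_measure_itv/=; case: ifP => _; rewrite -?EFinB ltry.
pose m := fine (lebesgue_measure D).
have mDE : lebesgue_measure D = m%:E by rewrite fineK// ge0_fin_numE.
suff bound e : 0 < e -> `|f b - f a| <= (1 + e) * (m + e) + e * (b - a).
  rewrite mDE lee_fin; apply/ler_addgt0Pr => e e0.
  (* For [e' <= 1] the error [e' * (m + 1 + e' + (b - a))] is at most [e' * C]. *)
  pose C := m + 2 + (b - a).
  have m0 : 0 <= m by rewrite fine_ge0.
  have C0 : 0 < C by rewrite /C; lra.
  pose e' := Num.min 1 (e / C).
  have e'0 : 0 < e' by rewrite lt_min ltr01 divr_gt0.
  have e'1 : e' <= 1 by rewrite ge_min lexx.
  have e'C : e' * C <= e by rewrite -ler_pdivlMr// ge_min lexx orbT.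
  apply: (le_trans (bound _ e'0)).
  move: e'C; rewrite /C; nra.
move=> e0.
have [U [oU DU Ue]] := lebesgue_regularity_outer mD Dfin e0.
have mU : measurable U by exact: measurable_realfun.open_measurable.
have Um : (lebesgue_measure U <= (m + e)%:E)%E.
  rewrite -(setDUK DU); apply: (le_trans (measureU2 _ _ _)) => //.
    exact: measurableD.
  by rewrite EFinD -mDE leeD2l// ltW.
(* The comparison function is [g t = (1 + e) |U `&` ]-oo, t]| + e t]: its slope
   is at least [1 + e] on [U] and at least [e] elsewhere. *)
pose W s t := fine (lebesgue_measure (U `&` `]s, t]%classic)).
have WE s t : lebesgue_measure (U `&` `]s, t]%classic) = (W s t)%:E.
  rewrite fineK// ge0_fin_numE//; apply: le_lt_trans (ltry (m + e)).
  apply: le_trans Um; apply: le_measure; rewrite ?inE//.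
  exact: measurableI.
have W0 s t : 0 <= W s t by rewrite fine_ge0.
(* Measuring from [-oo] makes [g] monotone on the whole line; the local bounds at [a] and [b] also
   look outside [[a, b]]. *)
pose V t := fine (lebesgue_measure (U `&` `]-oo, t]%classic)).
have VE t : lebesgue_measure (U `&` `]-oo, t]%classic) = (V t)%:E.
  rewrite fineK// ge0_fin_numE//; apply: le_lt_trans (ltry (m + e)).
  apply: le_trans Um; apply: le_measure; rewrite ?inE//.
  exact: measurableI.
have VD s t : s <= t -> V t = V s + W s t.
  move=> st; apply/EFin_inj; rewrite EFinD -WE -!VE.
  rewrite -measureU; [|exact: measurableI|exact: measurableI|].
    by rewrite -setIUr -(@itv_bndbnd_setU _ _ -oo%O (BRight s) (BRight t)).
  apply/seteqP; split=> // x [[_ /=]]; rewrite in_itv/= => xs [_ /=].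
  by rewrite in_itv/= ltNge xs.
have WU s t : s <= t -> `]s, t]%classic `<=` U -> W s t = t - s.
  move=> st stU; apply/EFin_inj; rewrite -WE setIidr// lebesgue_measure_itv/=.
  by rewrite lte_fin EFinB; case: ltgtP st => // -> _; rewrite subee.
have Wab : W a b <= m + e.
  rewrite -lee_fin -WE; apply: le_trans Um; apply: le_measure; rewrite ?inE//.
  exact: measurableI.
pose g t := (1 + e) * V t + e * t.
have gB s t : s <= t -> g t - g s = (1 + e) * W s t + e * (t - s).
  by move=> st; rewrite /g (VD s t st); ring.
have gle s t : s <= t -> e * (t - s) <= g t - g s.
  by move=> st; rewrite gB// lerDr mulr_ge0// addr_ge0// ltW.
have gh : {homo g : x y / x <= y}.
  move=> s t st; rewrite -subr_ge0; apply: le_trans (gle _ _ st).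
  by rewrite mulr_ge0 ?subr_ge0// ltW.
have gleN s t : e * `|t - s| <= `|g t - g s|.
  wlog st : s t / s <= t.
    by move=> H; have [/H//|/ltW/H] := leP s t; rewrite distrC (distrC (g s)).
  by rewrite !ger0_norm ?subr_ge0 ?gle// gh.
suff : `|f b - f a| <= g b - g a.
  move/le_trans; apply; rewrite gB// lerD2r ler_wpM2l//; lra.
apply: le_increment => // t tab.
have [Et|nEt] := pselect (E t); last first.
  have [|d d0 td] := @Lip_lt R f t e; first by rewrite fE indicE memNset.
  by exists d => // s ts; apply: le_trans (td s ts) (gleN _ _).
have [|d d0 td] := @Lip_lt R f t (1 + e).
  by rewrite fE indicE mem_set// lte_fin ltrDl.
have [r r0 tr] : exists2 r, 0 < r & forall s, `|t - s| < r -> U s.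
  have /nbhs_ballP[r /= r0 rU] : nbhs t U by apply: open_nbhs_nbhs; split => //; apply: DU.
  by exists r => // s ts; apply: rU.
exists (Num.min d r); first by rewrite lt_min d0.
move=> s; rewrite lt_min => /andP[tsd tsr].
apply: (le_trans (td s tsd)).
(* Inside [U] the increment of [V] is the full length, so [g] has slope [1 + 2e] there. *)
have gU x y : x <= y -> `]x, y]%classic `<=` U -> (1 + e) * `|y - x| <= `|g y - g x|.
  move=> xy xyU; rewrite !ger0_norm ?subr_ge0// ?gh// gB// WU// lerDl.
  by rewrite mulr_ge0 ?subr_ge0// ltW.
have [st|/ltW ts] := leP s t.
  apply: gU => // x /=; rewrite in_itv/= => /andP[sx xt]; apply: tr.
  move: tsr; rewrite !ger0_norm ?subr_ge0//; lra.
rewrite distrC (distrC (g t)); apply: gU => // x /=; rewrite in_itv/= => /andP[tx xs].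
apply: tr; move: tsr; rewrite distrC (distrC t x) !ger0_norm ?subr_ge0 ?(ltW tx)//; lra.
Qed.


Lemma Lip1_weakly_dense_at {R : realType} {E : set R} {x : R} :
  measurable E -> Lip1 E -> E x -> weakly_dense_at E x.
Proof.
move=> mE [f [_ fE]] Ex.
(* The strict inequality forces [y n] to differ from [x], even for [n = 0], where the factor
   vanishes. *)
have /choice[y yP] (n : nat) : exists y, `|x - y| < n.+1%:R^-1 /\
    (1 - n.+1%:R^-1) * `|x - y| < `|f x - f y|.
  have n1 : n.+1%:R^-1 <= 1 :> R by rewrite invf_le1 ?ler1n.
  have [|||y] := @Lip_gt R f x (1 - n.+1%:R^-1) _ _ n.+1%:R^-1.
  - by rewrite subr_ge0.
  - by rewrite fE indicE mem_set// lte_fin ltrBlDr ltrDl invr_gt0.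
  - by rewrite invr_gt0.
  - by exists y.
have xy n : 0 < `|x - y n|.
  rewrite normr_gt0 subr_eq0; apply/eqP => xyn.
  by have := (yP n).2; rewrite -xyn !subrr normr0 mulr0 ltxx.
(* [y n] may lie on either side of [x], which is always an endpoint of the interval. *)
pose a n := Num.min x (y n); pose b n := Num.max x (y n).
have ab n : b n - a n = `|x - y n|.
  by rewrite /a /b; case: leP => h; [rewrite distrC|];
    rewrite ger0_norm ?subr_ge0// ltW.
have altb n : a n < b n by rewrite -subr_gt0 ab.
have fab n : `|f (b n) - f (a n)| = `|f x - f (y n)|.
  by rewrite /a /b; case: leP => // _; rewrite distrC.
have muI n : completed_lebesgue_measure `[a n, b n]%classic = `|x - y n|%:E.
  by rewrite [LHS]lebesgue_measure_itv/= lte_fin altb -EFinB ab.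
exists (fun n => `[a n, b n]%classic); split; first split.
- by move=> n; exists (a n), (b n).
- by move=> n /=; rewrite in_itv/= ge_min le_max !lexx.
- rewrite (_ : (fun _ => _) = EFin \o (fun n => `|x - y n|)); last exact/funext.
  apply: cvg_EFin; first exact: nearW.
  apply: (squeeze_cvgr _ (cvg_cst 0) cvg_harmonic).
  by near=> n; rewrite normr_ge0 ltW// (yP n).1.
pose m n := fine (lebesgue_measure (E `&` `[a n, b n]%classic)).
have EI n : (lebesgue_measure (E `&` `[a n, b n]%classic) <= `|x - y n|%:E)%E.
  rewrite -muI; apply: (le_measure lebesgue_measure); rewrite ?inE//.
  exact: measurableI.
have mE' n : lebesgue_measure (E `&` `[a n, b n]%classic) = (m n)%:E.
  by rewrite fineK// ge0_fin_numE//; apply: le_lt_trans (EI n) (ltry _).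
rewrite (_ : (fun _ => _) = EFin \o (fun n => m n / `|x - y n|)); last first.
  apply/funext => n; rewrite muI [X in (X / _)%E]mE'/= inver.
  by rewrite gt_eqF//= EFinM.
apply: cvg_EFin; first exact: nearW.
(* The lower bound chains the choice of [y n] with [Lip_increment]; the upper one is [EI]. *)
apply: (@squeeze_cvgr _ _ _ _ (fun n => 1 - n.+1%:R^-1) (fun=> 1)); last exact: cvg_cst.
  near=> n; rewrite ler_pdivlMr// ler_pdivrMr// mul1r.
  rewrite -!lee_fin -mE' EI andbT; apply: le_trans (Lip_increment mE fE (ltW (altb n))).
  by rewrite fab lee_fin ltW// (yP n).2.
rewrite -[X in _ --> X]subr0; apply: cvgB; first exact: cvg_cst.
exact: cvg_harmonic.
Unshelve. all: by end_near.
Qed.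

Theorem theorem4p1 (R : realType) (E : set R) :
  Lip1 E -> weakly_dense E /\ Gdelta E.
Proof.
(* The G_delta property comes first because it supplies the Borel measurability that weak density
   needs. *)
move=> LE; have GE := Lip1_Gdelta LE; have mE := Gdelta_measurable GE.
split=> //; split; first exact: sub_caratheodory.
by move=> x; exact: Lip1_weakly_dense_at.
Qed.
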